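(* Let $T$ be a ring and let $M$ be a maximal right ideal of $T$ which is not a (two-sided) ideal of $T$. Then $|[M]|\geq |\mathbb{I}(M)/M|+1$. In particular, $|\operatorname{Max}_r(T)\setminus\operatorname{Max}(T)|\geq |\mathbb{I}(M)/M|+1$.
   Context: Rings are unital with $1\neq 0$. $\operatorname{Max}_r(T)$ is the set of maximal right ideals of $T$ and $\operatorname{Max}(T)$ is the set of maximal two-sided ideals of $T$. For a right ideal $A$ of $T$, $\mathbb{I}(A)=\{t\in T\mid tA\subseteq A\}$ is the idealizer of $A$, the largest subring of $T$ in which $A$ is a two-sided ideal. Right ideals $I,J$ of $T$ are similar if $T/I\cong T/J$ as right $T$-modules. For a maximal right ideal $M$, $[M]$ is the set of all (maximal) right ideals of $T$ similar to $M$. $|X|$ denotes the cardinality of $X$. *)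

(* Defs.v *)
From HB Require Import structures.
From mathcomp Require Import all_boot all_algebra.
From mathcomp Require Import boolp classical_sets functions cardinality.

Set Implicit Arguments.
Unset Strict Implicit.
Unset Printing Implicit Defensive.

Import GRing.Theory Quotient.

Local Open Scope classical_set_scope.
Local Open Scope ring_scope.

Record rightIdeal (T : nzRingType) := RightIdeal {
  rideal_set :> set T;
  rideal0 : rideal_set 0;
  ridealB : forall x y, rideal_set x -> rideal_set y -> rideal_set (x - y);
  ridealM : forall x t, rideal_set x -> rideal_set (x * t)
}.

Definition two_sided (T : nzRingType) (I : rightIdeal T) : Prop :=
  forall t x, rideal_set I x -> rideal_set I (t * x).

Definition proper_rideal (T : nzRingType) (I : rightIdeal T) : Prop :=
  I <> setT :> set T.

Definition Max_r (T : nzRingType) : set (rightIdeal T) :=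
  [set M | proper_rideal M /\
     forall J : rightIdeal T, proper_rideal J -> M `<=` J -> J `<=` M].

Arguments Max_r T : clear implicits.

(* Two-sided ideals are the right ideals satisfying [two_sided]; maximality is
   among proper two-sided ideals only. *)
Definition Max (T : nzRingType) : set (rightIdeal T) :=
  [set M | [/\ two_sided M, proper_rideal M &
     forall J : rightIdeal T,
       two_sided J -> proper_rideal J -> M `<=` J -> J `<=` M]].

Arguments Max T : clear implicits.

Definition idealizer (T : nzRingType) (A : set T) : set T :=
  [set t | forall a, A a -> A (t * a)].

Arguments idealizer {T} A.

(* A right T-module is a left module over the converse ring T^c, so T / I is
   the additive quotient {quot I} equipped with a T^c-module structure. *)
Section RightQuotient.
Variables (T : nzRingType) (I : rightIdeal T).

Definition rideal_pred : {pred T} := fun x => `[< rideal_set I x >].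

Lemma rideal_pred_zmod_closed : zmod_closed rideal_pred.
Proof.
split=> [|x y /asboolP Ix /asboolP Iy]; apply/asboolP; first exact: rideal0.
exact: ridealB.
Qed.

HB.instance Definition _ :=
  GRing.isZmodClosed.Build T rideal_pred rideal_pred_zmod_closed.

Definition rquot : Type := {quot rideal_pred}.

HB.instance Definition _ := GRing.Zmodule.on rquot.

Definition rquot_pi (x : T) : rquot := \pi_({quot rideal_pred})%qT x.

Lemma rquot_piE x y : rquot_pi x = rquot_pi y <-> rideal_set I (x - y).
Proof.
split=> [/eqP|Ixy].
  by rewrite /rquot_pi -idealrBE => /asboolP.
by apply/eqP; rewrite /rquot_pi -idealrBE; apply/asboolP.
Qed.

Lemma rquot_piD : {morph rquot_pi : x y / x + y}.
Proof. by move=> x y; rewrite /rquot_pi raddfD. Qed.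

Lemma rquot_piK (u : rquot) : rquot_pi (repr (u : {quot rideal_pred})) = u.
Proof. exact: reprK. Qed.

Definition rquot_scale (t : T^c) (u : rquot) : rquot :=
  rquot_pi (repr (u : {quot rideal_pred}) * (t : T)).

Lemma rquot_scaleE (t x : T) : rquot_scale t (rquot_pi x) = rquot_pi (x * t).
Proof.
by apply/rquot_piE; rewrite -mulrBl; apply/ridealM/rquot_piE/rquot_piK.
Qed.

Lemma rquot_scaleA (a b : T^c) (v : rquot) :
  rquot_scale a (rquot_scale b v) = rquot_scale (a * b) v.
Proof. by rewrite -[v]rquot_piK !rquot_scaleE -mulrA. Qed.

Lemma rquot_scale1 : left_id (1 : T^c) rquot_scale.
Proof. by move=> v; rewrite -[v]rquot_piK rquot_scaleE mulr1. Qed.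

Lemma rquot_scaleDr : right_distributive rquot_scale +%R.
Proof.
move=> a u v; rewrite -[u]rquot_piK -[v]rquot_piK -rquot_piD !rquot_scaleE.
by rewrite mulrDl rquot_piD.
Qed.

Lemma rquot_scaleDl (v : rquot) :
  {morph (fun a : T^c => rquot_scale a v) : a b / a + b}.
Proof.
by move=> a b; rewrite -[v]rquot_piK !rquot_scaleE mulrDr rquot_piD.
Qed.

HB.instance Definition _ := GRing.Zmodule_isLmodule.Build T^c rquot
  rquot_scaleA rquot_scale1 rquot_scaleDr rquot_scaleDl.

End RightQuotient.

Arguments rquot_pi {T} I x.

Definition similar_rideal (T : nzRingType) (I J : rightIdeal T) : Prop :=
  exists f : {linear rquot I -> rquot J}, bijective f.

Definition sim_class (T : nzRingType) (M : rightIdeal T) : set (rightIdeal T) :=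
  [set J | similar_rideal M J].

Arguments sim_class {T} M.

(* I(M) / M, as the set of cosets t + M in T / M with t in I(M). *)
Definition idealizer_quot (T : nzRingType) (M : rightIdeal T) : set (rquot M) :=
  [set rquot_pi M t | t in idealizer M].

Arguments idealizer_quot {T} M.

(* I(M) / M together with one extra point: a set of
   cardinality |I(M) / M| + 1, whether or not I(M) / M is finite. *)
Definition idealizer_quot_plus1 (T : nzRingType) (M : rightIdeal T) :
  set (option (rquot M)) := None |` [set Some u | u in idealizer_quot M].

Arguments idealizer_quot_plus1 {T} M.

(* Main.v *)
Require Import Defs.
From HB Require Import structures.
From mathcomp Require Import all_boot all_algebra.
From mathcomp Require Import boolp classical_sets functions cardinality.

Set Implicit Arguments.
Unset Strict Implicit.
Unset Printing Implicit Defensive.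

Import GRing.Theory.

Local Open Scope classical_set_scope.
Local Open Scope card_scope.

(** The maximal right ideal [M] is the annihilator of the vector [1] of the
    simple module [V = T / M], whose endomorphism division ring is
    [D = I(M) / M]. Annihilators of nonzero vectors are similar to [M], and two
    of them agree only if the vectors are proportional over [D]. As [M] is not
    two-sided, some [x] lies outside [D * 1]; then [1] and the [x + d], for [d]
    in [D], span distinct lines of [V], and their annihilators are
    [|D| + 1] distinct right ideals similar to [M]. *)

Section SimilarMaximalRightIdeals.
Variable T : nzRingType.
Local Open Scope ring_scope.
Implicit Types (M J K : rightIdeal T) (r t u v x y z : T).

Lemma ridealN {M x} : rideal_set M x -> rideal_set M (- x).
Proof. by move=> Mx; rewrite -sub0r; apply: ridealB => //; apply: rideal0. Qed.

Lemma ridealD {M x y} :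
  rideal_set M x -> rideal_set M y -> rideal_set M (x + y).
Proof. by move=> Mx My; rewrite -[y]opprK; apply/ridealB/ridealN. Qed.

Lemma rideal_congr {M x y} :
  rideal_set M (x - y) -> rideal_set M x <-> rideal_set M y.
Proof.
move=> Mxy; split=> [Mx|My]; last by rewrite -(subrK y x); apply: ridealD.
by rewrite -(subKr x y); apply: ridealB.
Qed.

Lemma proper_ridealP M : proper_rideal M <-> ~ rideal_set M 1.
Proof.
split=> [Mp M1|M1 MT]; last by apply: M1; rewrite MT.
apply: Mp; apply/seteqP; split=> // x _.
by rewrite -[x]mul1r; apply: ridealM.
Qed.

Section Transporter.
Variables (M : rightIdeal T) (v : T).

Let A : set T := [set r | rideal_set M (v * r)].

Fact transporter0 : A 0.
Proof. by rewrite /A /= mulr0; apply: rideal0. Qed.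

Fact transporterB x y : A x -> A y -> A (x - y).
Proof. by rewrite /A /= mulrBr; apply: ridealB. Qed.

Fact transporterM x t : A x -> A (x * t).
Proof. by rewrite /A /= mulrA; apply: ridealM. Qed.

(* The annihilator of the class of [v] in [T / M]. *)
Definition transporter : rightIdeal T :=
  @RightIdeal T A transporter0 transporterB transporterM.

Let S : set T := [set y | exists m r, rideal_set M m /\ y = m + v * r].

Fact add_principal0 : S 0.
Proof. by exists 0, 0; rewrite mulr0 addr0; split=> //; apply: rideal0. Qed.

Fact add_principalB x y : S x -> S y -> S (x - y).
Proof.
move=> [m [r [Mm ->]]] [n [s [Mn ->]]]; exists (m - n), (r - s).
by split; [apply: ridealB | rewrite mulrBr opprD addrACA].
Qed.

Fact add_principalM x t : S x -> S (x * t).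
Proof.
move=> [m [r [Mm ->]]]; exists (m * t), (r * t).
by rewrite mulrDl mulrA; split=> //; apply: ridealM.
Qed.

Definition add_principal : rightIdeal T :=
  @RightIdeal T S add_principal0 add_principalB add_principalM.

End Transporter.

(** By maximality [M + vT] is all of [T], so it contains 1: every nonzero class generates
    [T / M]. *)
Lemma Max_r_inv {M v} : Max_r T M -> ~ rideal_set M v ->
  exists r, rideal_set M (v * r - 1).
Proof.
move=> [Mp maxM] Mv; apply: contrapT => noinv; apply: Mv.
have SM : rideal_set (add_principal M v) `<=` rideal_set M.
  apply: maxM => [|m Mm]; last by exists m, 0; rewrite mulr0 addr0.
  apply/proper_ridealP => -[m [r [Mm e1]]]; apply: noinv; exists r.
  by rewrite e1 opprD addrCA subrr addr0; apply: ridealN.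
by apply: SM; exists 0, 1; rewrite mulr1 add0r; split=> //; apply: rideal0.
Qed.

(** An instance of Schur's lemma: as [u] idealizes [M], the annihilator of its class contains [M];
    being proper, it lies in [M]. *)
Lemma idealizer_lreg {M u z} : Max_r T M -> idealizer M u ->
  ~ rideal_set M u -> rideal_set M (u * z) -> rideal_set M z.
Proof.
move=> [Mp maxM] Iu Mu; apply: (maxM (transporter M u)) => //.
by apply/proper_ridealP; rewrite /= mulr1.
Qed.

Lemma idealizerB {M x y} :
  idealizer M x -> idealizer M y -> idealizer M (x - y).
Proof.
by move=> Ix Iy a Ma; rewrite mulrBl; apply: ridealB; [apply: Ix|apply: Iy].
Qed.

Lemma idealizerM {M x y} :
  idealizer M x -> idealizer M y -> idealizer M (x * y).
Proof. by move=> Ix Iy a Ma; rewrite -mulrA; apply/Ix/Iy. Qed.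

Lemma idealizer1 {M} : idealizer M 1.
Proof. by move=> a Ma; rewrite mul1r. Qed.

Lemma sub_idealizer M : rideal_set M `<=` idealizer M.
Proof. by move=> x Mx a _; apply: ridealM. Qed.

Lemma idealizer_congr {M x y} :
  rideal_set M (x - y) -> idealizer M y -> idealizer M x.
Proof.
move=> Mxy Iy a Ma; apply/(@rideal_congr _ _ (y * a)); last exact: Iy.
by rewrite -mulrBl; apply: ridealM.
Qed.

(* Left multiplication by [r] induces an isomorphism [T / M -> T / J]. *)
Lemma similar_ridealP M J : similar_rideal M J <->
  exists r u, (forall y, rideal_set M y <-> rideal_set J (r * y)) /\
              rideal_set J (r * u - 1).
Proof.
split=> [[f [g fK gK]]|[r [u [rP ru]]]].
  (* A linear map is determined by the image of the class of 1, so [r] is taken to represent that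
     image under [f], and [u] the one under [g]. *)
  have fE y : f (rquot_pi M y) = rquot_pi J (repr (f (rquot_pi M 1)) * y).
    rewrite -rquot_scaleE rquot_piK -[in LHS](mul1r y) -rquot_scaleE.
    exact: (linearZ_LR f (y : T^c)).
  set r := repr _ in fE.
  exists r, (repr (g (rquot_pi J 1))); split=> [y|].
    have -> : rideal_set M y <-> rquot_pi M y = rquot_pi M 0.
      by rewrite rquot_piE subr0.
    have -> : rideal_set J (r * y) <-> f (rquot_pi M y) = f (rquot_pi M 0).
      by rewrite !fE mulr0 rquot_piE subr0.
    by split=> [->//|/(can_inj fK)].
  by apply/rquot_piE; rewrite -fE rquot_piK gK.
pose f (a : rquot M) : rquot J := rquot_pi J (r * repr a).
have fE y : f (rquot_pi M y) = rquot_pi J (r * y).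
  apply/rquot_piE; rewrite -mulrBr; apply/rP/rquot_piE; exact: rquot_piK.
have f_lin : linear f.
  move=> a b c; rewrite -[b]rquot_piK -[c]rquot_piK.
  rewrite [a *: _]rquot_scaleE -rquot_piD !fE [a *: _]rquot_scaleE -rquot_piD.
  by rewrite mulrDr mulrA.
pose fL : {linear rquot M -> rquot J} :=
  HB.pack f (GRing.isLinear.Build _ _ _ _ f f_lin).
(* The inverse multiplies representatives by [u]. One composite is the identity since [r * u] is 1
   modulo [J]; the other becomes so after applying [r], which reflects membership. *)
exists fL, (fun b : rquot J => rquot_pi M (u * repr b)) => [a|b] /=.
  rewrite -[RHS]rquot_piK; apply/rquot_piE/rP; rewrite mulrBr mulrA.
  apply/rquot_piE; rewrite -/(f a) -[RHS](rquot_piK (f a)); apply/rquot_piE.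
  by rewrite -[X in _ - X]mul1r -mulrBl; apply: ridealM.
rewrite fE -[RHS]rquot_piK; apply/rquot_piE.
by rewrite mulrA -[X in _ - X]mul1r -mulrBl; apply: ridealM.
Qed.

Lemma similar_refl M : similar_rideal M M.
Proof.
apply/similar_ridealP; exists 1, 1; split=> [y|]; first by rewrite mul1r.
by rewrite mulr1 subrr; apply: rideal0.
Qed.

(** If [r] is a right inverse of [v] modulo [M], left multiplications by [r] and [v] are mutually
    inverse: [v * (r * v - 1) = (v * r - 1) * v] lies in [M]. *)
Lemma similar_transporter M v :
  Max_r T M -> ~ rideal_set M v -> similar_rideal M (transporter M v).
Proof.
move=> maxM Mv; have [r vr] := Max_r_inv maxM Mv.
apply/similar_ridealP; exists r, v; split=> [y|/=].
  rewrite /= mulrA; apply: iff_sym; apply: rideal_congr.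
  by rewrite -[X in _ - X]mul1r -mulrBl; apply: ridealM.
rewrite mulrBr mulr1 mulrA -[X in _ - X]mul1r -mulrBl.
exact: ridealM.
Qed.

Lemma similar_Max_r M J : Max_r T M -> similar_rideal M J -> Max_r T J.
Proof.
move=> [/proper_ridealP M1 maxM] /similar_ridealP[r [u [rP ru]]].
split=> [|K /proper_ridealP K1 JK z Kz].
  apply/proper_ridealP => J1; apply/M1/rP.
  by rewrite mulr1 -[r]mul1r; apply: ridealM.
(* The preimage of [K] under left multiplication by [r] contains [M], and is proper because [r] in
   [K] would put [r * u], hence 1, in [K]. *)
have KM : rideal_set (transporter K r) `<=` rideal_set M.
  apply: maxM => [|y /rP/JK//].
  apply/proper_ridealP; rewrite /= mulr1 => Kr; apply: K1.
  by apply/(rideal_congr (JK _ ru)); apply: ridealM.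
have ruz : rideal_set J (r * (u * z) - z).
  by rewrite mulrA -[X in _ - X]mul1r -mulrBl; apply: ridealM.
apply/(rideal_congr ruz)/rP/KM/(rideal_congr (JK _ ruz)); exact: Kz.
Qed.

(** If [J] were two-sided, [y] in [J] would give [r * y] in [J], hence [y] in [M]; maximality of [J]
    then forces [J = M]. *)
Lemma similar_not_two_sided M J : Max_r T M -> similar_rideal M J ->
  ~ two_sided M -> ~ two_sided J.
Proof.
move=> maxM simJ M2 J2; apply: M2.
have [_ maxJ] := similar_Max_r maxM simJ.
move/similar_ridealP: simJ => [r [u [rP _]]].
have JM : rideal_set J `<=` rideal_set M by move=> y Jy; apply/rP/J2.
have MJ : rideal_set M `<=` rideal_set J by apply: maxJ => //; case: maxM.
by move=> t x /MJ Jx; apply/JM/J2.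
Qed.

(* If [x + t] and [x + s] have the same annihilator, they differ by a factor
   [d] in [D]; as [x] is not in [D * 1], comparing coefficients of [x] gives
   [d = 1]. *)
Lemma transporter_inj M x s t : Max_r T M -> ~ idealizer M x ->
  idealizer M s -> idealizer M t ->
  transporter M (x + t) = transporter M (x + s) -> rideal_set M (t - s).
Proof.
move=> maxM Ix Is It eqJ.
have annE y : rideal_set M ((x + t) * y) <-> rideal_set M ((x + s) * y).
  by have := congr1 (fun J => rideal_set J y) eqJ => /= ->.
have Mxs : ~ rideal_set M (x + s).
  move=> /sub_idealizer Ixs; apply: Ix; rewrite -(addrK s x).
  exact: idealizerB.
(* As [r] inverts [x + s] on the right modulo [M], this [d] is the only candidate for the factor. *)
have [r xsr] := Max_r_inv maxM Mxs; pose d := (x + t) * r.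
have Id : idealizer M d.
  move=> m Mm; rewrite -mulrA; apply/annE; rewrite mulrA.
  apply/(rideal_congr (y := m)) => //.
  by rewrite -[X in _ - X]mul1r -mulrBl; apply: ridealM.
(* The element [1 - r * (x + s)] annihilates [x + s] modulo [M], hence also [x + t]. *)
have dP : rideal_set M ((x + t) - d * (x + s)).
  rewrite /d -mulrA -[X in X - _]mulr1 -mulrBr; apply/annE.
  by rewrite mulrBr mulr1 mulrA -[X in X - _]mul1r -mulrBl
    -opprB mulNr; apply/ridealN/ridealM.
have dxP : rideal_set M ((1 - d) * x - (d * s - t)).
  move: dP; congr (rideal_set M _).
  by rewrite mulrDr mulrBl mul1r !opprD !opprK addrACA [t + _]addrC.
have [M1d|M1d] := EM (rideal_set M (1 - d)).
  have := ridealB dP (ridealM (x + s) M1d).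
  rewrite mulrBl mul1r opprB addrA subrK.
  by rewrite opprD addrACA subrr add0r.
(* Otherwise [1 - d] can be cancelled modulo [M]; as [(1 - d) * x] is congruent to [d * s - t],
   which idealizes [M], so would [x]. *)
case: Ix => m Mm; apply: (idealizer_lreg maxM (idealizerB idealizer1 Id)) => //.
rewrite mulrA; apply: (idealizer_congr dxP) => //.
by apply: idealizerB => //; apply: idealizerM.
Qed.

Lemma idealizer_repr M (a : rquot M) :
  idealizer_quot M a -> idealizer M (repr a).
Proof.
by move=> [t It <-]; apply: idealizer_congr It; apply/rquot_piE/rquot_piK.
Qed.

Lemma idealizer_quot_le_sim_class M : Max_r T M -> ~ two_sided M ->
  idealizer_quot_plus1 M #<= sim_class M.
Proof.
move=> maxM M2.
have [x Ix] : exists x, ~ idealizer M x.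
  apply: contrapT => noI; apply: M2 => t; apply: contrapT => It.
  by apply: noI; exists t.
have Ixt t : idealizer M t -> ~ idealizer M (x + t).
  by move=> It Ixt; apply: Ix; rewrite -(addrK t x); apply: idealizerB.
(* The extra point goes to [M], the annihilator of 1. No other point does, since [x + repr a] would
   then idealize [M]. *)
pose g o := if o is Some a then transporter M (x + repr (a : rquot M)) else M.
have g_None (a : rquot M) : idealizer_quot M a -> g (Some a) <> M.
  move=> /idealizer_repr Ia eqM; apply: (Ixt _ Ia) => m Mm.
  by move: Mm; rewrite -[in X in X -> _]eqM.
have SomeP (a : rquot M) :
    idealizer_quot_plus1 M (Some a) -> idealizer_quot M a.
  by move=> [//|[b Ib ba]]; case: ba Ib => ->.
have g_inj : {in idealizer_quot_plus1 M &, injective g}.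
  move=> [a|] [b|] /set_mem Ia /set_mem Ib //.
  - move=> gab; rewrite -[a]rquot_piK -[b]rquot_piK; congr Some.
    apply/rquot_piE; apply: transporter_inj gab => //;
      by apply/idealizer_repr/SomeP.
  - by move=> /g_None; case; apply: SomeP.
  - by move=> /esym/g_None; case; apply: SomeP.
rewrite -(card_le_eql (inj_card_eq g_inj)).
apply: subset_card_le => _ [[a /SomeP /idealizer_repr Ia|_] <-]; last first.
  exact: similar_refl.
by apply: similar_transporter => // /sub_idealizer; apply: Ixt.
Qed.

End SimilarMaximalRightIdeals.

Theorem theorem3p21 (T : nzRingType) (M : rightIdeal T)
    (hmax : Max_r T M) (hnot2 : ~ two_sided M) :
  (idealizer_quot_plus1 M #<= sim_class M) /\
  (idealizer_quot_plus1 M #<= Max_r T `\` Max T).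
Proof.
have le_sim := idealizer_quot_le_sim_class hmax hnot2; split=> //.
apply: (card_le_trans le_sim); apply: subset_card_le => J simJ.
split; first exact: similar_Max_r simJ.
by case=> J2 _ _; apply: similar_not_two_sided simJ hnot2 J2.
Qed.
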